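(* Let $d\ge 1$, let $p_n^-$ be the (positive, differentiable) prior particle density on $\mathbb{R}^d$, let $p_{Y|X}(Y_{t_n}|\cdot)$ be the likelihood of the observed value $Y_{t_n}$ and $p_Y(Y_{t_n})>0$ the value of the density of the observation. Let $\hat p_n^*$ be the Bayes-updated density and $p_n$ the density of the controlled particle produced by the control $v:\mathbb{R}^d\to\mathbb{R}^d$ (both defined in the context). Then the control input $v$ obtained by minimizing the $f$-divergence $D_f(\hat p_n^*\|p_n)$ is independent of the choice of the $f$-divergence: no matter what $f$ is, the control input $v$ always satisfies the equation (an identity of row vectors of length $d$, at every $x\in\mathbb{R}^d$) $$0=\nabla_x^T\big[p_n^-(x+v)\,p_{Y|X}(Y_{t_n}|x+v)\big]\,p_n^-(x)+p_n^-(x+v)\,p_{Y|X}(Y_{t_n}|x+v)\left[\mathrm{tr}\left((I+\nabla v^T)^{-1}\frac{\partial(\nabla v^T)}{\partial x_i}\right)\right]_{i=1,\dots,d}p_n^-(x)-p_n^-(x+v)\,p_{Y|X}(Y_{t_n}|x+v)\,\nabla_x^T p_n^-(x),$$ where $v=v(x)$.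
   Context: Notation: $\nabla v^T$ is the $d\times d$ matrix with $(i,j)$ entry $\partial v_j/\partial x_i$ (the transpose of the Jacobian of $v$), $I$ is the identity matrix, $|A|$ is the determinant of $A$, $\nabla_x^T g$ is the row vector $(\partial g/\partial x_1,\dots,\partial g/\partial x_d)$ of the derivatives of $x\mapsto g$ (so in $\nabla_x^T[g(x+v)]$ the composite function $x\mapsto g(x+v(x))$ is differentiated), and $[c_i]_{i=1,\dots,d}$ is the row vector with entries $c_i$. Setting: at a fixed observation time $t_n$, $p_n^-$ is the conditional density of the particle before the update. The Bayes update is $$\hat p_n^*(s)=\frac{p_n^-(s)\,p_{Y|X}(Y_{t_n}|s)}{p_Y(Y_{t_n})},\qquad s\in\mathbb{R}^d.$$ A particle at $x$ is moved by the control to $s=x+v(x)$, where $I+\nabla v^T$ is assumed invertible for all $x$; its updated density is $$p_n(s)=\frac{p_n^-(x)}{|I+\nabla v^T(x)|},\qquad s=x+v(x).$$ For a function $f$, the $f$-divergence is $D_f(p_1\|p_2)=\int_{\mathbb{R}^d}p_2(s)\,f\big(p_1(s)/p_2(s)\big)\,ds$. By the change of variables $s=x+v(x)$, $$D_f(\hat p_n^*\|p_n)=\int_{\mathbb{R}^d}\mathcal{L}(x,v,\nabla v^T)\,dx,\qquad \mathcal{L}(x,v,\nabla v^T)=p_n^-(x)\,f(\xi),\qquad \xi=\frac{p_n^-(x+v)\,p_{Y|X}(Y_{t_n}|x+v)\,|I+\nabla v^T|}{p_n^-(x)\,p_Y(Y_{t_n})}.$$ ''The control input obtained by minimizing $D_f(\hat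 p_n^*\|p_n)$'' means the solution $v$ of the Euler-Lagrange equation of this functional, i.e. for $i=1,\dots,d$, $$\frac{\partial\mathcal{L}}{\partial v_i}=\sum_{j=1}^d\frac{\partial}{\partial x_j}\left(\frac{\partial\mathcal{L}}{\partial(\partial v_i/\partial x_j)}\right).$$ All functions ($f$, $p_n^-$, $p_{Y|X}(Y_{t_n}|\cdot)$, $v$) are taken smooth enough for these expressions to make sense.
   Formalization: The function f is assumed to be affine on no nondegenerate interval of an open set containing the values of ξ (e.g. f strictly convex), since for affine f every v solves the Euler–Lagrange equation and the claim fails. *)

(* Defs.v *)
From HB Require Import structures.
From mathcomp Require Export all_boot all_order all_algebra.
From mathcomp Require Export all_classical all_reals all_analysis.
From mathcomp Require Import ring.

Set Implicit Arguments.
Unset Strict Implicit.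
Unset Printing Implicit Defensive.

Export Order.TTheory GRing.Theory Num.Theory.
Export numFieldNormedType.Exports.

Open Scope classical_set_scope.
Open Scope ring_scope.

Section calculus.
Context {R : realType} {d : nat}.
Implicit Types (x w : 'rV[R]_d) (A : 'M[R]_d) (i j : 'I_d).

Definition evec i : 'rV[R]_d := delta_mx ord0 i.

Definition partial (g : 'rV[R]_d -> R) i x : R := 'D_(evec i) g x.

(* The row vector nabla_x^T g. *)
Definition grad (g : 'rV[R]_d -> R) x : 'rV[R]_d := \row_i partial g i x.

Definition coordf (v : 'rV[R]_d -> 'rV[R]_d) i : 'rV[R]_d -> R :=
  fun x => v x ord0 i.

(* nabla v^T: the (i, j) entry is d v_j / d x_i. *)
Definition gradT (v : 'rV[R]_d -> 'rV[R]_d) x : 'M[R]_d :=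
  \matrix_(i, j) partial (coordf v j) i x.

(* d (nabla v^T) / d x_i, entrywise. *)
Definition dgradT (v : 'rV[R]_d -> 'rV[R]_d) i x : 'M[R]_d :=
  \matrix_(k, l) partial (fun y => gradT v y k l) i x.

Definition C2 (v : 'rV[R]_d -> 'rV[R]_d) : Prop :=
  forall k,
  [/\ forall x, differentiable (coordf v k) x,
      forall i x, differentiable (partial (coordf v k) i) x
    & forall i j, continuous (partial (partial (coordf v k) i) j)].

(* A Lagrangian L takes the point x, the value w of v and the value A of
   nabla v^T as independent variables; the slot d v_i / d x_j is the (j, i)
   entry of A, hence the direction delta_mx j i. *)
Definition euler_lagrange (L : 'rV[R]_d -> 'rV[R]_d -> 'M[R]_d -> R)
    (v : 'rV[R]_d -> 'rV[R]_d) : Prop :=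
  forall i x,
    'D_(evec i) (fun w => L x w (gradT v x)) (v x) =
    \sum_j partial
      (fun y => 'D_(delta_mx j i) (fun A => L y (v y) A) (gradT v y)) j x.

End calculus.

Section divergence.
Context {R : realType} {d : nat}.
Variables (prior lik : 'rV[R]_d -> R) (pY : R).
Implicit Types (x w : 'rV[R]_d) (A : 'M[R]_d).

Definition bayes_update (s : 'rV[R]_d) : R := prior s * lik s / pY.

(* Density, at s = x + v(x), of the particle moved from x, where A is
   nabla v^T (x). *)
Definition moved_density x A : R := prior x / \det (1%:M + A).

Definition xi x w A : R :=
  (prior (x + w) * lik (x + w) * \det (1%:M + A)) / (prior x * pY).

Lemma xiE x w A : xi x w A = bayes_update (x + w) / moved_density x A.
Proof.
by rewrite /xi /bayes_update /moved_density !invfM invrK; ring.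
Qed.

Definition lagrangian (f : R -> R) x w A : R := prior x * f (xi x w A).

End divergence.

(* f is a twice differentiable function on the open set J that is affine on no
   nondegenerate interval; e.g. J = ]0, +oo[ and f strictly convex.  The last
   condition cannot be dropped: if f is affine then prior * f(xi) is a null
   Lagrangian, and every v solves its Euler-Lagrange equation. *)
Definition admissible {R : realType} (J : set R) (f : R -> R) : Prop :=
  [/\ open J,
      forall t, J t -> derivable f t 1,
      forall t, J t -> derivable (derive1 f) t 1
    & forall a b : R, a < b -> (forall t, a < t < b -> J t) ->
        ~ exists c e : R, forall t, a < t < b -> f t = c * t + e].

(* Main.v *)
Require Import Defs.
From mathcomp Require Import ring lra.

Set Implicit Arguments.
Unset Strict Implicit.
Unset Printing Implicit Defensive.

(* Write q = prior * lik, M = I + nabla v^T and X(x) = xi(x, v, nabla v^T).  In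
   the Euler-Lagrange equation the terms carrying f'(X) cancel, by the chain
   rule for q(x + v(x)) and Piola's identity (the cofactor matrix of M is
   divergence free); as the cofactor matrix is invertible, what remains is
   f''(X) q(x + v) nabla X = 0.  Where q(x + v) = 0, the function q is minimal
   and nabla X = 0.  Hence f' o X has zero gradient and is constant, so that X
   is constant too, since otherwise f would be affine on an interval of values
   of X.  The equation of the theorem is nabla X = 0 multiplied by
   prior^2 pY / det M, and nabla X = 0 solves the Euler-Lagrange equation of
   every f. *)

(** * Differential calculus: chain rules, determinants, mean values along lines *)

Section derivatives.
Context {R : realType}.
Implicit Types U V W : normedModType R.

Lemma derive_comp U V W (g : V -> W) (f : U -> V) x u :
  differentiable f x -> differentiable g (f x) ->
  'D_u (g \o f) x = 'D_('D_u f x) g (f x).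
Proof.
move=> df dg; rewrite deriveE; last exact: differentiable_comp.
by rewrite diff_comp//= -deriveE// -deriveE.
Qed.

Lemma derive_comp1 V (g : R -> R) (f : V -> R) x u :
  differentiable f x -> derivable g (f x) 1 ->
  'D_u (g \o f) x = derive1 g (f x) * 'D_u f x.
Proof.
move=> df dg; have dg' : differentiable g (f x) by apply/derivable1_diffP.
rewrite derive_comp// deriveE// deriv1E//=.
by rewrite mulrC.
Qed.

Lemma differentiable_bigsum V W (I : Type) (r : seq I) (P : pred I)
    (F : I -> V -> W) x :
  (forall i, differentiable (F i) x) ->
  differentiable (fun y => \sum_(i <- r | P i) F i y) x.
Proof.
move=> dF; elim: r => [|i r IH].
  by under eq_fun do rewrite big_nil; exact: differentiable_cst.
under eq_fun do rewrite big_cons; case: (P i) => //.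
exact: (differentiableD (f := F i)).
Qed.

Lemma differentiable_bigprod V (I : Type) (r : seq I) (P : pred I)
    (F : I -> V -> R) x :
  (forall i, differentiable (F i) x) ->
  differentiable (fun y => \prod_(i <- r | P i) F i y) x.
Proof.
move=> dF; elim: r => [|i r IH].
  by under eq_fun do rewrite big_nil; exact: differentiable_cst.
under eq_fun do rewrite big_cons; case: (P i) => //.
exact: (differentiableM (f := F i)).
Qed.

Lemma differentiable_mx V m n (M : V -> 'M[R]_(m, n)) x :
  (forall i j, differentiable (fun y => M y i j) x) -> differentiable M x.
Proof.
move=> dM.
have -> : M = fun y => \sum_i \sum_j (M y i j) *: delta_mx i j.
  by apply/funext => y; rewrite {1}(matrix_sum_delta (M y)).
apply: differentiable_bigsum => i; apply: differentiable_bigsum => j.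
exact: (differentiableZl (k := fun y => M y i j)).
Qed.

Lemma differentiable_entry V m n (M : V -> 'M[R]_(m, n)) x i j :
  differentiable M x -> differentiable (fun y => M y i j) x.
Proof.
move=> dM; apply: (differentiable_comp (g := fun N : 'M[R]_(m, n) => N i j)) => //.
exact: differentiable_coord.
Qed.

Lemma derive_entry V m n (M : V -> 'M[R]_(m, n)) x u i j :
  differentiable M x -> 'D_u M x i j = 'D_u (fun y => M y i j) x.
Proof. by move=> /diff_derivable dM; rewrite derive_mx// mxE. Qed.

Lemma differentiable_det n (A : 'M[R]_n) :
  differentiable (fun B : 'M[R]_n => \det B) A.
Proof.
apply: (@differentiable_bigsum _ R _ _ xpredT) => s.
apply: (differentiableM (f := cst _)); first exact: differentiable_cst.
apply: differentiable_bigprod => i; exact: differentiable_coord.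
Qed.

Lemma differentiable_cofactor n (A : 'M[R]_n) i j :
  differentiable (fun B : 'M[R]_n => cofactor B i j) A.
Proof.
apply: (differentiableM (f := cst _)); first exact: differentiable_cst.
apply: (differentiable_comp (f := fun B : 'M[R]_n => row' i (col' j B)));
  last exact: differentiable_det.
apply: differentiable_mx => k l.
under eq_fun do rewrite !mxE.
exact: differentiable_coord.
Qed.

(** The difference quotient is equal to [c] for every [h != 0], so differentiability of [f] need not
    be known beforehand. *)
Lemma derive_affine V W (f : V -> W) x u c :
  (forall h : R, f (h *: u + x) = f x + h *: c) -> 'D_u f x = c.
Proof.
move=> fE; apply/cvg_lim => //.
apply/cvgrPdist_lt => e e0; near=> h.
rewrite /= fE [f x + _]addrC addrK scalerA mulVf ?scale1r ?subrr ?normr0//.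
near: h; exact: nbhs_dnbhs_neq.
Unshelve. all: by end_near. Qed.

(** By Laplace expansion along row [i], the determinant is affine in the entry [(i, j)], with the
    cofactor as slope. *)
Lemma derive_det_delta n (A : 'M[R]_n) i j :
  'D_(delta_mx i j) (fun B : 'M[R]_n => \det B) A = cofactor A i j.
Proof.
apply: derive_affine => h.
rewrite (expand_det_row _ i) (expand_det_row A i).
(* The cofactors of row [i] do not involve the entries of row [i], the only row that is
   perturbed. *)
have cofE k : cofactor (h *: delta_mx i j + A) i k = cofactor A i k.
  rewrite /cofactor; congr (_ * \det _); apply/matrixP => a b.
  by rewrite !mxE eq_sym (negPf (neq_lift _ _)) mulr0 add0r.
under eq_bigr do rewrite cofE !mxE eqxx/= mulrDl.
rewrite big_split/= addrC; congr (_ + _).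
rewrite (bigD1 j)//= eqxx mulr1 big1 ?addr0// => k /negPf ->.
by rewrite mulr0 mul0r.
Qed.

(** Jacobi's formula: the differential of the determinant is linear, so it is determined by its
    values on the elementary matrices, which are the cofactors. *)
Lemma derive_det V n (M : V -> 'M[R]_n) x u : differentiable M x ->
  'D_u (fun y => \det (M y)) x = \tr (\adj (M x) *m 'D_u M x).
Proof.
move=> dM.
rewrite (derive_comp (g := fun B : 'M[R]_n => \det B))//;
  last exact: differentiable_det.
have dd := differentiable_det (M x).
rewrite deriveE// [in LHS](matrix_sum_delta ('D_u M x)) linear_sum/=.
rewrite mxtrace_mulC; apply: eq_bigr => i _.
rewrite linear_sum mxE/=; apply: eq_bigr => j _.
by rewrite linearZ/= -deriveE// derive_det_delta mxE.
Qed.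

Lemma derive_mul V (f g : V -> R) x u :
  differentiable f x -> differentiable g x ->
  'D_u (fun y => f y * g y) x = f x * 'D_u g x + g x * 'D_u f x.
Proof. by move=> df dg; apply: deriveM; exact: diff_derivable. Qed.

Lemma derive_bigsum V n (F : 'I_n -> V -> R) x u :
  (forall i, differentiable (F i) x) ->
  'D_u (fun y => \sum_i F i y) x = \sum_i 'D_u (F i) x.
Proof.
move=> dF; rewrite -derive_sum; last by move=> i; exact: diff_derivable.
by congr ('D_u _ x); apply/funext => y; rewrite fct_sumE.
Qed.

Lemma derive_mulr_cst V (f : V -> R) c x u : differentiable f x ->
  'D_u (fun y => f y * c) x = 'D_u f x * c.
Proof.
move=> df; rewrite (derive_mul (g := cst c))//.
by rewrite derive_cst mulr0 add0r mulrC.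
Qed.

Lemma differentiable_translate V W (f : V -> W) a x :
  differentiable f (a + x) -> differentiable (fun y => f (a + y)) x.
Proof.
by move=> df; exact: (differentiable_comp (f := fun y => a + y) (g := f)).
Qed.

Lemma derive_translate V W (f : V -> W) a x u : differentiable f (a + x) ->
  'D_u (fun y => f (a + y)) x = 'D_u f (a + x).
Proof.
move=> df; rewrite (derive_comp (f := fun y => a + y) (g := f))//.
rewrite (@derive_affine _ _ (fun y => a + y) _ _ u)// => h.
by rewrite addrCA addrC.
Qed.

(** Restriction to a line turns directional derivatives into ordinary ones, which gives access to
    the one-variable theorems on mean values, intermediate values and minima. *)
Lemma is_derive_line V (f : V -> R) x u t :
  differentiable f (x + t *: u) ->
  is_derive t 1 (fun t : R => f (x + t *: u)) ('D_u f (x + t *: u)).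
Proof.
move=> df.
have dl : differentiable (fun t : R => x + t *: u) t.
  apply: (differentiableD (f := cst x)); first exact: differentiable_cst.
  exact: (differentiableZl (k := @id R)).
have -> : 'D_u f (x + t *: u) = 'D_1 (fun t : R => f (x + t *: u)) t.
  rewrite (derive_comp (g := f) (f := fun t : R => x + t *: u))//.
  congr ('D_ _ _ _); symmetry; apply: derive_affine => h.
  by rewrite [_%:A]mulr1 scalerDl addrAC addrA.
by apply: derivableP; apply: diff_derivable; apply: (differentiable_comp (g := f)).
Qed.

Lemma MVT_line V (f : V -> R) x u (h : R) : 0 <= h ->
  (forall y, differentiable f y) ->
  exists2 c, 0 <= c <= h & f (x + h *: u) - f x = h * 'D_u f (x + c *: u).
Proof.
move=> h0 df.
have fd (t : R) := is_derive_line (df (x + t *: u)).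
have [|c ch] := MVT_segment h0 (fun t _ => fd t).
  by apply: derivable_within_continuous => t _; exact: ex_derive.
by rewrite scale0r addr0 subr0 mulrC => E; exists c.
Qed.

(** The mean value theorem is used twice: along [u] for the increment [phi] of [f] in the direction
    [w], then along [w] for ['D_u f]. *)
Lemma second_difference V (f : V -> R) x u w (h : R) : 0 <= h ->
  (forall y, differentiable f y) -> (forall y, differentiable ('D_u f) y) ->
  exists s t, [/\ 0 <= s <= h, 0 <= t <= h &
    f (x + h *: u + h *: w) - f (x + h *: u) - (f (x + h *: w) - f x) =
    h * (h * 'D_w ('D_u f) (x + s *: u + t *: w))].
Proof.
move=> h0 df ddf.
pose phi y := f (y + h *: w) - f y.
have dsh y : differentiable (fun z => f (z + h *: w)) y.
  exact: (differentiable_comp (g := f)).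
have dphi y : differentiable phi y.
  exact: (differentiableB (f := fun z => f (z + h *: w))).
have [s sh E] := MVT_line x u h0 dphi.
have [t th E'] := MVT_line (x + s *: u) w h0 ddf.
exists s, t; split => //; rewrite -E' -/(phi (x + h *: u)) -/(phi x) E.
congr (_ * _).
rewrite (deriveB (f := fun z => f (z + h *: w))); try exact: diff_derivable.
rewrite (derive_comp (g := f) (f := fun z => z + h *: w))//.
rewrite (@derive_affine _ _ (fun z => z + h *: w) _ _ u)// => k.
by rewrite [k *: u + _]addrC addrAC.
Qed.

(* The mixed second difference is symmetric in u and w, and the mean
   value theorem identifies it with either mixed derivative near x. *)
Lemma derive_symmetric V (f : V -> R) x u w :
  (forall y, differentiable f y) ->
  (forall y, differentiable ('D_u f) y) -> (forall y, differentiable ('D_w f) y) ->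
  {for x, continuous ('D_w ('D_u f))} -> {for x, continuous ('D_u ('D_w f))} ->
  'D_w ('D_u f) x = 'D_u ('D_w f) x.
Proof.
move=> df duf dwf cwu cuw.
apply/eqP; rewrite -subr_eq0 -normr_eq0; apply/negPn/negP => ne0.
set e := `|_| in ne0; have e0 : 0 < e / 2 by rewrite divr_gt0// lt_def ne0 normr_ge0.
have /nbhs_ballP[r /= r0 rP] : \forall y \near x,
    `|'D_w ('D_u f) x - 'D_w ('D_u f) y| < e / 2 /\
    `|'D_u ('D_w f) x - 'D_u ('D_w f) y| < e / 2.
  apply: filterI.
    by move/cvgrPdist_lt: cwu; exact.
  by move/cvgrPdist_lt: cuw; exact.
(* The summand 1 keeps [k] positive when [u = w = 0] and makes [h * (|u| + |w|)] strictly less than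
   [h * k = r]. *)
pose k := `|u| + `|w| + 1.
have k0 : 0 < k by rewrite /k ltr_wpDl.
pose h := r / k.
have h0 : 0 < h by rewrite divr_gt0.
have near_x s t : 0 <= s <= h -> 0 <= t <= h -> ball x r (x + s *: u + t *: w).
  move=> /andP[s0 sh] /andP[t0 th].
  rewrite -ball_normE/= -addrA opprD addNKr normrN.
  apply: (@le_lt_trans _ _ (h * (`|u| + `|w|))).
    rewrite (le_trans (ler_normD _ _))// !normrZ !ger0_norm// mulrDr.
    by rewrite lerD// ler_wpM2r.
  by rewrite -(divfK (lt0r_neq0 k0) r) -/h ltr_pM2l// /k ltrDl.
have [s [t [sh th E]]] := second_difference x w (ltW h0) df duf.
have [s' [t' [sh' th' E']]] := second_difference x u (ltW h0) df dwf.
(* Both sides, multiplied by [h] twice, are the same second difference of [f]. *)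
have F : 'D_w ('D_u f) (x + s *: u + t *: w) = 'D_u ('D_w f) (x + t' *: u + s' *: w).
  have S : f (x + h *: u + h *: w) - f (x + h *: u) - (f (x + h *: w) - f x) =
           f (x + h *: w + h *: u) - f (x + h *: w) - (f (x + h *: u) - f x).
    by rewrite (addrAC x (h *: w)) !opprD !opprK addrACA.
  have hN0 := lt0r_neq0 h0.
  have := etrans (esym E) (etrans S E').
  by rewrite (addrAC x (s' *: w)) => /(mulfI hN0)/(mulfI hN0).
have [H _] := rP _ (near_x _ _ sh th).
have [_ H'] := rP _ (near_x _ _ th' sh').
rewrite F in H; rewrite distrC in H'.
(* The triangle inequality through the common value [F] yields [e < e / 2 + e / 2]. *)
have := le_lt_trans (ler_normD _ _) (ltrD H H').
by rewrite addrA subrK -splitr ltxx.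
Qed.

Lemma zero_derive_cst V (f : V -> R) : (forall y, differentiable f y) ->
  (forall x u, 'D_u f x = 0) -> forall x y, f x = f y.
Proof.
move=> df f0 x y.
have [c _] := MVT_line x (y - x) ler01 df.
by rewrite f0 mulr0 scale1r subrKC => /eqP; rewrite subr_eq0 => /eqP.
Qed.

(** On the line through [x] in the direction [u], the parameter 0 is an interior minimum. *)
Lemma derive_at_min V (f : V -> R) x u : (forall y, differentiable f y) ->
  (forall y, f x <= f y) -> 'D_u f x = 0.
Proof.
move=> df fmin; have fd (t : R) := is_derive_line (df (x + t *: u)).
suff : is_derive (0 : R) (1 : R) (fun t : R => f (x + t *: u)) 0.
  by case=> _; case: (fd 0) => _ ->; rewrite scale0r addr0.
apply: (@derive1_at_min _ _ (-1) 1); first by lra.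
- by move=> t _; exact: ex_derive.
- by rewrite in_itv/=; apply/andP; split; lra.
- by move=> t _; rewrite scale0r addr0.
Qed.

End derivatives.

(** * Leibniz rules for matrix products and the adjugate *)

Section matrices.
Context {R : realType}.
Implicit Types V : normedModType R.

Lemma derive_mulmx V m n p (A : V -> 'M[R]_(m, n)) (B : V -> 'M[R]_(n, p)) x u :
  differentiable A x -> differentiable B x ->
  'D_u (fun y => A y *m B y) x = 'D_u A x *m B x + A x *m 'D_u B x.
Proof.
move=> dA dB.
have dAB i j k : differentiable (fun y => A y i k * B y k j) x.
  by apply: (@differentiableM _ _ (fun y => A y i k)); exact: differentiable_entry.
apply/matrixP => i j; rewrite derive_entry; last first.
  apply: differentiable_mx => a b; under eq_fun do rewrite mxE.
  exact: differentiable_bigsum.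
under eq_fun do rewrite mxE.
rewrite derive_bigsum// !mxE -big_split/=; apply: eq_bigr => k _.
rewrite !derive_entry// derive_mul; [|exact: differentiable_entry..].
by rewrite addrC (mulrC (B x k j)).
Qed.

Lemma differentiable_adj V n (M : V -> 'M[R]_n) x :
  differentiable M x -> differentiable (fun y => \adj (M y)) x.
Proof.
move=> dM; apply: differentiable_mx => i j; under eq_fun do rewrite mxE.
apply: (differentiable_comp (g := fun B : 'M[R]_n => cofactor B j i)) => //.
exact: differentiable_cofactor.
Qed.

(** This is the derivative of [\adj M *m M = (\det M)%:M]. It gives the derivative of the adjugate
    only after multiplication by [M], which is enough when [M] is invertible. *)
Lemma derive_adj V n (M : V -> 'M[R]_n) x u : differentiable M x ->
  'D_u (fun y => \adj (M y)) x *m M x =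
  ('D_u (fun y => \det (M y)) x)%:M - \adj (M x) *m 'D_u M x.
Proof.
move=> dM; apply/eqP; rewrite eq_sym subr_eq eq_sym; apply/eqP.
rewrite -derive_mulmx//; last exact: differentiable_adj.
under eq_fun do rewrite mul_adj_mx.
have dd : differentiable (fun y => \det (M y)) x.
  by apply: (differentiable_comp (g := fun B : 'M[R]_n => \det B)) => //;
    exact: differentiable_det.
under eq_fun do rewrite -scalemx1.
apply/matrixP => i j; rewrite derive_entry; last first.
  exact: (differentiableZl (k := fun y => \det (M y))).
under eq_fun do rewrite !mxE.
rewrite !mxE derive_mul//.
by rewrite derive_cst mulr0 add0r mulr_natl.
Qed.

End matrices.

(** * Second derivatives of the control and Piola's identity *)

Section C2_maps.
Context {R : realType} {d : nat} (v : 'rV[R]_d -> 'rV[R]_d) (v_C2 : C2 v).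

Lemma C2_differentiable x : differentiable v x.
Proof.
apply: differentiable_mx => i j; rewrite (ord1 i).
by have [+ _ _] := v_C2 j; exact.
Qed.

Lemma gradT_entry k l : (fun y => gradT v y k l) = partial (coordf v l) k.
Proof. by apply/funext => y; rewrite mxE. Qed.

Lemma differentiable_gradT x : differentiable (gradT v) x.
Proof.
apply: differentiable_mx => i j; rewrite gradT_entry.
by have [_ + _] := v_C2 j; exact.
Qed.

(** The transposed Jacobian matrix of the map [x + v x]. *)
Definition jacT x : 'M[R]_d := 1%:M + gradT v x.

Lemma differentiable_jacT x : differentiable jacT x.
Proof.
apply: (@differentiableD _ _ _ (cst 1%:M)); first exact: differentiable_cst.
exact: differentiable_gradT.
Qed.

Lemma derive_jacT i x : 'D_(evec i) jacT x = dgradT v i x.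
Proof.
rewrite (@deriveD _ _ _ (cst 1%:M) (gradT v)); last first.
- exact: diff_derivable (differentiable_gradT x).
- exact: derivable_cst.
rewrite derive_cst add0r; apply/matrixP => k l.
by rewrite derive_entry ?mxE//; exact: differentiable_gradT.
Qed.

Lemma dgradT_entry i x k l :
  dgradT v i x k l = partial (partial (coordf v l) k) i x.
Proof.
transitivity (partial (fun y => gradT v y k l) i x); first by rewrite mxE.
exact: (f_equal (fun g => partial g i x) (gradT_entry k l)).
Qed.

(** Both sides are mixed second derivatives of component [l] of [v], taken in opposite orders. *)
Lemma dgradT_symmetric i j x l : dgradT v i x j l = dgradT v j x i l.
Proof.
have [df ddf cdf] := v_C2 l;
apply: etrans (dgradT_entry i x j l) (etrans _ (esym (dgradT_entry j x i l))).
exact: (@derive_symmetric _ _ (coordf v l) x (evec j) (evec i)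
          df (ddf j) (ddf i) (cdf j i x) (cdf i j x)).
Qed.

Hypothesis v_unit : forall x, jacT x \in unitmx.

(* With N = M^-1 and H_jl^k the second derivatives of v_k, both parts of
   d_j (det M N_ij) = d_j (adj M)_ij sum over j to det M N_kl H_jl^k N_ij. *)
Lemma piola i x : \sum_j partial (fun y => cofactor (jacT y) j i) j x = 0.
Proof.
have dJ := differentiable_jacT x.
set M := jacT x; set N := invmx M.
have adjE : \adj M = \det M *: N.
  rewrite /N /invmx v_unit scalerA divrr ?scale1r//.
  by have := v_unit x; rewrite unitmxE.
have cofE j : partial (fun y => cofactor (jacT y) j i) j x =
    \det M * (\tr (N *m dgradT v j x) * N i j - (N *m dgradT v j x *m N) i j).
  transitivity ('D_(evec j) (fun y => \adj (jacT y)) x i j).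
    rewrite derive_entry; last exact: differentiable_adj.
    by under [in RHS]eq_fun do rewrite mxE.
  (* Inserting [M *m N = 1] creates the factor [M] that [derive_adj] requires. *)
  have -> : 'D_(evec j) (fun y => \adj (jacT y)) x =
      'D_(evec j) (fun y => \adj (jacT y)) x *m M *m N by rewrite mulmxK// v_unit.
  rewrite derive_adj// derive_det//.
  rewrite derive_jacT -/M adjE -/N mulmxBl mul_scalar_mx -!scalemxAl linearZ/=.
  by rewrite !mxE mulrBr mulrA.
rewrite (eq_bigr _ (fun j _ => cofE j)) -big_distrr/= sumrB.
rewrite (_ : \sum_j _ = \sum_j (N *m dgradT v j x *m N) i j) ?subrr ?mulr0//.
(* Symmetry of the second derivatives turns the left triple sum into the right one with [j] and [l]
   interchanged; the exchanges of summation below carry out this renaming. *)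
under eq_bigr => j _.
  rewrite /mxtrace big_distrl/=.
  under eq_bigr => k _.
    rewrite mxE big_distrl/=.
    under eq_bigr => l _ do rewrite (dgradT_symmetric j l).
    over.
  over.
under [RHS]eq_bigr => j _.
  rewrite mxE.
  under eq_bigr => k _ do rewrite mxE big_distrl/=.
  over.
rewrite [RHS]exchange_big/=.
under [RHS]eq_bigr => k _ do rewrite exchange_big/=.
rewrite [RHS]exchange_big/=.
apply: eq_bigr => j _; apply: eq_bigr => k _; apply: eq_bigr => l _.
by ring.
Qed.

End C2_maps.

(** * The Euler-Lagrange equation in terms of the gradient of [ratio] *)

Section euler_lagrange_equation.
Context {R : realType} {d : nat}.
Variables (prior lik : 'rV[R]_d -> R) (pY : R) (v : 'rV[R]_d -> 'rV[R]_d).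
Hypotheses (prior_gt0 : forall x, 0 < prior x)
  (prior_diff : forall x, differentiable prior x)
  (lik_diff : forall x, differentiable lik x)
  (pY_gt0 : 0 < pY)
  (v_C2 : C2 v)
  (v_unit : forall x, jacT v x \in unitmx).

Let q s := prior s * lik s.
Let moved y := y + v y.
(** The argument of [f] along the control [v], called [X] in the overview. *)
Let ratio y := xi prior lik pY y (v y) (gradT v y).

Let dq s : differentiable q s.
Proof. exact: (@differentiableM _ _ prior lik). Qed.

Let dmoved y : differentiable moved y.
Proof. by apply: (@differentiableD _ _ _ id v) => //; exact: C2_differentiable. Qed.

Let dqm y : differentiable (fun y => q (moved y)) y.
Proof. exact: (differentiable_comp (f := moved) (g := q)). Qed.

Let ddet y : differentiable (fun y => \det (jacT v y)) y.
Proof.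
apply: (differentiable_comp (g := fun B : 'M[R]_d => \det B)).
  exact: differentiable_jacT.
exact: differentiable_det.
Qed.

Let dcof i j y : differentiable (fun y => cofactor (jacT v y) i j) y.
Proof.
apply: (differentiable_comp (g := fun B : 'M[R]_d => cofactor B i j)).
  exact: differentiable_jacT.
exact: differentiable_cofactor.
Qed.

Let det_neq0 x : \det (jacT v x) != 0.
Proof. by have := v_unit x; rewrite unitmxE unitfE. Qed.

Let prior_neq0 x : prior x != 0. Proof. exact: lt0r_neq0. Qed.
Let pY_neq0 : pY != 0. Proof. exact: lt0r_neq0. Qed.

Let ratioE y : ratio y = q (moved y) * \det (jacT v y) * (prior y * pY)^-1.
Proof. by []. Qed.

Lemma differentiable_ratio y : differentiable ratio y.
Proof.
apply: (@differentiableM _ _ (fun y => q (moved y) * \det (jacT v y))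
         (fun y => (prior y * pY)^-1)).
  exact: (@differentiableM _ _ (fun y => q (moved y)) (fun y => \det (jacT v y))).
apply: (@differentiableV _ _ (fun y => prior y * pY)).
  by apply: (@differentiableM _ _ prior (cst pY)).
by rewrite mulf_neq0.
Qed.

Lemma partial_moved (g : 'rV[R]_d -> R) j x : differentiable g (moved x) ->
  partial (fun y => g (moved y)) j x =
  \sum_k jacT v x j k * partial g k (moved x).
Proof.
move=> dg; rewrite /partial (derive_comp (f := moved) (g := g))//.
(* A row and not a column, since [jacT] is the transposed Jacobian. *)
have -> : 'D_(evec j) moved x = row j (jacT v x).
  rewrite (@deriveD _ _ _ id v); last 2 first.
  - exact: derivable_id.
  - exact/diff_derivable/C2_differentiable.
  rewrite derive_id; apply/rowP => k; rewrite !mxE derive_entry ?mxE.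
    by rewrite eqxx/= [k == j]eq_sym.
  exact: C2_differentiable.
rewrite deriveE// [row j _]row_sum_delta linear_sum; apply: eq_bigr => k _.
by rewrite linearZ/= -deriveE// mxE.
Qed.

(** The parenthesis on the right is the [i]-th entry of the equation of the theorem. Differentiating
    [ratio * (prior * pY) = q(moved) * det] avoids the derivative of a quotient. *)
Lemma partial_ratio i x :
  prior x ^+ 2 * pY * partial ratio i x = \det (jacT v x) *
    (prior x * partial (fun y => q (moved y)) i x
     + q (moved x) * prior x * \tr (invmx (jacT v x) *m dgradT v i x)
     - q (moved x) * partial prior i x).
Proof.
have dr := differentiable_ratio x.
have E : (fun y => ratio y * (prior y * pY)) =
         (fun y => q (moved y) * \det (jacT v y)).
  by apply/funext => y; rewrite ratioE divfK// mulf_neq0.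
have dp : differentiable (fun y => prior y * pY) x.
  by apply: (@differentiableM _ _ prior (cst pY)).
have := f_equal (fun g => partial g i x) E.
rewrite /partial (derive_mul _ dr dp) (derive_mul _ (dqm x) (ddet x)).
rewrite derive_mulr_cst// derive_det; last exact: differentiable_jacT.
rewrite derive_jacT//.
have -> : \adj (jacT v x) = \det (jacT v x) *: invmx (jacT v x).
  by rewrite /invmx v_unit scalerA divff// scale1r.
rewrite -scalemxAl linearZ/= ratioE.
set D := 'D_(evec i) (fun y => q (moved y)) x.
set Dp := 'D_(evec i) prior x; set Dr := 'D_(evec i) ratio x.
set t := \tr _; set e := \det _; set Q := q _ => H.
have {}H : prior x * pY * Dr = Q * (e * t) + e * D - Q * e * Dp / prior x.
  rewrite -H; field; by rewrite prior_neq0 pY_neq0.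
transitivity (prior x * (prior x * pY * Dr)); first by ring.
by rewrite H; field; rewrite prior_neq0.
Qed.

Variables (f : R -> R).
Hypotheses (f_der : forall x, derivable f (ratio x) 1)
  (f_der2 : forall x, derivable (derive1 f) (ratio x) 1).

Let df y : differentiable f (ratio y).
Proof. exact/derivable1_diffP. Qed.

(** With [x] and the matrix frozen, [xi] is a constant times [q (x + w)]; the factor [prior x] of
    the Lagrangian cancels the one in the denominator of [xi]. *)
Lemma lagrangian_dvalue i x :
  'D_(evec i) (fun w => lagrangian prior lik pY f x w (gradT v x)) (v x) =
  derive1 f (ratio x) * (\det (jacT v x) * partial q i (moved x)) / pY.
Proof.
pose X w := q (x + w) * (\det (jacT v x) / (prior x * pY)).
have XE w : xi prior lik pY x w (gradT v x) = X w by rewrite /X mulrA.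
have -> : (fun w => lagrangian prior lik pY f x w (gradT v x)) =
          (fun w => (f \o X) w * prior x).
  by apply/funext => w; rewrite /lagrangian XE mulrC.
have dX : differentiable X (v x).
  apply: (@differentiableM _ _ (fun w => q (x + w)) (cst _)) => //.
    exact: differentiable_translate.
have rX : X (v x) = ratio x by rewrite -XE.
rewrite derive_mulr_cst; last first.
  by apply: differentiable_comp => //; rewrite rX.
rewrite derive_comp1 ?rX// /X derive_mulr_cst; last exact: differentiable_translate.
rewrite derive_translate// -/(moved x) /partial; field.
by rewrite prior_neq0 pY_neq0.
Qed.

(** With the point and the value of [v] frozen, [xi] is a constant times the determinant, whose
    derivative in one entry is a cofactor. *)
Lemma lagrangian_dslope i j y :
  'D_(delta_mx j i) (fun A : 'M[R]_d => lagrangian prior lik pY f y (v y) A)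
    (gradT v y) =
  derive1 f (ratio y) * (q (moved y) * cofactor (jacT v y) j i) / pY.
Proof.
pose X (A : 'M[R]_d) := \det (1%:M + A) * (q (moved y) / (prior y * pY)).
have XE A : xi prior lik pY y (v y) A = X A by rewrite /X mulrA [\det _ * _]mulrC.
have -> : (fun A : 'M[R]_d => lagrangian prior lik pY f y (v y) A) =
          (fun A : 'M[R]_d => (f \o X) A * prior y).
  by apply/funext => A; rewrite /lagrangian XE mulrC.
have dd := differentiable_det (1%:M + gradT v y).
have dX : differentiable X (gradT v y).
  apply: (@differentiableM _ _ (fun A : 'M[R]_d => \det (1%:M + A)) (cst _)) => //.
  exact: (differentiable_translate (f := fun A : 'M[R]_d => \det A)).
have rX : X (gradT v y) = ratio y by rewrite -XE.
rewrite derive_mulr_cst; last first.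
  by apply: differentiable_comp => //; rewrite rX.
rewrite derive_comp1 ?rX// /X derive_mulr_cst; last first.
  exact: (differentiable_translate (f := fun A : 'M[R]_d => \det A)).
rewrite (derive_translate _ (f := fun A : 'M[R]_d => \det A))//.
rewrite derive_det_delta; field.
by rewrite prior_neq0 pY_neq0.
Qed.

(** The product rule splits the divergence into three sums. Derivatives of cofactors vanish by
    Piola's identity, derivatives of [q] reproduce the derivative in [v_i], and derivatives of [f']
    leave the defect. *)
Lemma euler_lagrange_defect i x :
  \sum_j partial (fun y => 'D_(delta_mx j i)
      (fun A : 'M[R]_d => lagrangian prior lik pY f y (v y) A) (gradT v y)) j x =
  'D_(evec i) (fun w => lagrangian prior lik pY f x w (gradT v x)) (v x) +
  derive1 (derive1 f) (ratio x) * q (moved x) / pY *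
    \sum_j partial ratio j x * cofactor (jacT v x) j i.
Proof.
have dfr : differentiable (derive1 f \o ratio) x.
  apply: differentiable_comp; first exact: differentiable_ratio.
  exact/derivable1_diffP.
set f' := derive1 f (ratio x); set f'' := derive1 (derive1 f) (ratio x).
have partialE j : partial (fun y => 'D_(delta_mx j i)
      (fun A : 'M[R]_d => lagrangian prior lik pY f y (v y) A) (gradT v y)) j x =
    f' / pY * (q (moved x) * partial (fun y => cofactor (jacT v y) j i) j x) +
    f' / pY * (\sum_k (jacT v x j k * cofactor (jacT v x) j i) *
                 partial q k (moved x)) +
    f'' * q (moved x) / pY * (partial ratio j x * cofactor (jacT v x) j i).
  under eq_fun do rewrite lagrangian_dslope.
  have dqc : differentiable (fun y => q (moved y) * cofactor (jacT v y) j i) x.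
    exact: (@differentiableM _ _ (fun y => q (moved y))).
  rewrite {1}/partial derive_mulr_cst;
    last exact: (@differentiableM _ _ (derive1 f \o ratio)).
  rewrite (derive_mul (f := derive1 f \o ratio))// derive_mul//.
  rewrite (derive_comp1 _ (differentiable_ratio x) (@f_der2 x)).
  rewrite -/(partial (fun y => q (moved y)) j x) partial_moved//.
  rewrite -/(partial ratio j x) -/(partial (fun y => cofactor (jacT v y) j i) j x).
  have -> : \sum_k (jacT v x j k * cofactor (jacT v x) j i) * partial q k (moved x) =
      cofactor (jacT v x) j i * \sum_k jacT v x j k * partial q k (moved x).
    by rewrite big_distrr; apply: eq_bigr => k _ /=; ring.
  rewrite /= -/f' -/f''; ring.
have cofM : \sum_j \sum_k (jacT v x j k * cofactor (jacT v x) j i) *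
    partial q k (moved x) = \det (jacT v x) * partial q i (moved x).
  rewrite exchange_big/=.
  (* The sum over [j] is an entry of [\adj M *m M = (\det M)%:M], so only [k = i] survives. *)
  transitivity (\sum_k (\adj (jacT v x) *m jacT v x) i k * partial q k (moved x)).
    apply: eq_bigr => k _; rewrite -big_distrl [(_ *m _) i k]mxE/=; congr (_ * _).
    by apply: eq_bigr => j _; rewrite [\adj _ _ _]mxE mulrC.
  rewrite mul_adj_mx (bigD1 i)//= big1 ?addr0 => [|k ki].
    by rewrite mxE eqxx.
  by rewrite mxE eq_sym (negPf ki) mul0r.
rewrite (eq_bigr _ (fun j _ => partialE j)) !big_split/= -!big_distrr/=.
rewrite piola// mulr0 mulr0 add0r lagrangian_dvalue; congr (_ + _).
by rewrite cofM mulrAC.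
Qed.

Lemma euler_lagrange_ratio : euler_lagrange (lagrangian prior lik pY f) v <->
  forall j x, derive1 (derive1 f) (ratio x) * q (moved x) * partial ratio j x = 0.
Proof.
split=> [EL j x|EL i x]; last first.
  rewrite euler_lagrange_defect big_distrr/= big1 ?addr0// => j _.
  rewrite mulrA [_ / pY * _]mulrAC EL; ring.
(* The defects for all [i] say that [c] is annihilated by the transposed adjugate; multiplying by
   the transpose of [jacT] leaves [\det (jacT v x) *: c = 0]. *)
pose c := \row_k (derive1 (derive1 f) (ratio x) * q (moved x) * partial ratio k x).
suff : c = 0 by move/rowP/(_ j); rewrite !mxE.
have : c *m (\adj (jacT v x))^T = 0.
  apply/rowP => i; rewrite !mxE.
  have /eqP := EL i x; rewrite euler_lagrange_defect -{1}[X in X == _]addr0.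
  rewrite (inj_eq (addrI _)) eq_sym => /eqP H.
  apply: etrans (etrans (f_equal ( *%R pY) H) (mulr0 _)).
  rewrite !big_distrr/=; apply: eq_bigr => j' _; rewrite !mxE; field.
  by rewrite pY_neq0.
move=> H; have : c *m ((\adj (jacT v x))^T *m (jacT v x)^T) = 0.
  by rewrite mulmxA H mul0mx.
rewrite -trmx_mul mul_mx_adj tr_scalar_mx mul_mx_scalar => /eqP.
by rewrite scaler_eq0 (negPf (det_neq0 x))/= => /eqP.
Qed.

End euler_lagrange_equation.

(** * Constancy of [X] from the vanishing of [f''(X)] times its derivatives *)

Section constancy.
Context {R : realType}.
Implicit Types V : normedModType R.

Lemma derive_eq0_partial d (g : 'rV[R]_d -> R) x u : differentiable g x ->
  (forall i, partial g i x = 0) -> 'D_u g x = 0.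
Proof.
move=> dg g0; rewrite deriveE// (row_sum_delta u) linear_sum big1// => i _.
by rewrite linearZ/= -deriveE// [X in _ *: X]g0 scaler0.
Qed.

Lemma IVT_line V (X : V -> R) x y t : (forall z, differentiable X z) ->
  X x <= t <= X y -> exists z, X z = t.
Proof.
move=> dX /andP[xt ty].
have fd (s : R) := is_derive_line (dX (x + s *: (y - x))).
have [|||s _ <-] := @IVT R (fun s => X (x + s *: (y - x))) 0 1 t.
- exact: ler01.
- by apply: derivable_within_continuous => s _; exact: ex_derive.
- by rewrite scale0r addr0 scale1r subrKC ge_min xt/= le_max ty orbT.
by exists (x + s *: (y - x)).
Qed.

(* f' o X has zero derivative, hence is constant; if X took two values, then f'
   would be constant, and f affine, on the interval between them. *)
Lemma admissible_comp_cst V (J : set R) f (X : V -> R) : admissible J f ->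
  (forall x, J (X x)) -> (forall x, differentiable X x) ->
  (forall x u, derive1 (derive1 f) (X x) * 'D_u X x = 0) ->
  forall x y, X x = X y.
Proof.
case=> _ fd fdd naff XJ dX X0.
have df' x : differentiable (derive1 f \o X) x.
  by apply: differentiable_comp => //; exact/derivable1_diffP/fdd/XJ.
have f'X := zero_derive_cst df'.
have {}f'X x y : derive1 f (X x) = derive1 f (X y).
  apply: f'X => z u; rewrite derive_comp1//; exact/fdd/XJ.
(* As [x] and [y] are arbitrary, one inequality is enough; its failure gives a nondegenerate
   interval of values of [X]. *)
suff Hle x y : X x <= X y.
  by move=> x y; apply/eqP; rewrite eq_le !Hle.
rewrite leNgt; apply/negP => yx.
have val t : X y <= t <= X x -> exists z, X z = t by exact: IVT_line.
apply: (naff _ _ yx) => [t /andP[yt tx]|].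
  by have [|z <-] := val t; [rewrite !ltW|exact: XJ].
(* The line through the point of the graph of [f] at [X y], with the constant value of [f'] as
   slope. *)
exists (derive1 f (X x)), (f (X y) - derive1 f (X x) * X y) => t /andP[yt tx].
have fder s : X y <= s <= X x -> is_derive s 1 f (derive1 f (X x)).
  move=> /val[z <-]; rewrite (f'X x z) derive1E.
  exact/derivableP/fd/XJ.
have [s|s|s _] := @MVT R f (fun=> derive1 f (X x)) _ _ yt.
- rewrite in_itv/= => /andP[ys st]; apply: fder.
  by rewrite ltW//= ltW// (lt_trans st).
- apply: derivable_within_continuous => z; rewrite in_itv/= => /andP[yz zt].
  apply: (ex_derive (is_derive := _)); apply: fder.
  by rewrite yz (le_trans zt)// ltW.
- by move=> E; rewrite -[LHS](subrK (f (X y))) E; ring.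
Qed.

End constancy.

(** * The control equation and its independence of [f] *)

Theorem theorem3p1 (R : realType) (d : nat) (hd : (1 <= d)%N)
  (prior lik : 'rV[R]_d -> R) (pY : R) (v : 'rV[R]_d -> 'rV[R]_d)
  (prior_gt0 : forall x, 0 < prior x)
  (prior_diff : forall x, differentiable prior x)
  (lik_ge0 : forall x, 0 <= lik x)
  (lik_diff : forall x, differentiable lik x)
  (pY_gt0 : 0 < pY)
  (v_C2 : C2 v)
  (v_unit : forall x, (1%:M + gradT v x) \in unitmx)
  (J : set R) (f : R -> R) (f_adm : admissible J f)
  (xi_J : forall x, J (xi prior lik pY x (v x) (gradT v x)))
  (v_EL : euler_lagrange (lagrangian prior lik pY f) v) :
  (forall x,
     let q := fun s => prior s * lik s in
     0 = prior x *: grad (fun y => q (y + v y)) x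
         + (q (x + v x) * prior x) *:
             \row_i \tr (invmx (1%:M + gradT v x) *m dgradT v i x)
         - q (x + v x) *: grad prior x)
  /\
  (forall (K : set R) (g : R -> R), admissible K g ->
     (forall x, K (xi prior lik pY x (v x) (gradT v x))) ->
     euler_lagrange (lagrangian prior lik pY g) v).
Proof.
pose X y := xi prior lik pY y (v y) (gradT v y).
pose q s := prior s * lik s.
have dX := differentiable_ratio prior_gt0 prior_diff lik_diff pY_gt0 v_C2.
have dXE := partial_ratio prior_gt0 prior_diff lik_diff pY_gt0 v_C2 v_unit.
have ELE g K : admissible K g -> (forall x, K (X x)) ->
    euler_lagrange (lagrangian prior lik pY g) v <->
    forall j x, derive1 (derive1 g) (X x) * q (x + v x) * partial X j x = 0.
  move=> [_ gd gdd _] XK.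
  by apply: euler_lagrange_ratio => // x; [exact/gd/XK|exact/gdd/XK].
have dq s : differentiable q s by exact: (@differentiableM _ _ prior lik).
have q0 j x : q (x + v x) = 0 -> partial X j x = 0.
  move=> qx0; have := dXE j x; rewrite -/(q _) qx0 !mul0r addr0 subr0.
  (* Since [q] is nonnegative, a zero of [q] is a minimum, so all its partial derivatives vanish
     there and the chain rule removes the last term. *)
  rewrite (partial_moved v_C2 _ (dq _)) big1 => [|k _]; last first.
    rewrite [partial _ _ _]derive_at_min ?mulr0// => y.
    by rewrite -/(q _) qx0 mulr_ge0// ltW.
  rewrite !mulr0 => /eqP; rewrite !mulf_eq0 (gt_eqF (prior_gt0 x)).
  by rewrite (gt_eqF pY_gt0) => /eqP.
have X0 j x : partial X j x = 0.
  have Xcst : forall x y, X x = X y.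
    apply: (admissible_comp_cst f_adm xi_J dX) => {}x u.
    (* Where [f''(X)] is nonzero, the gradient of [X] vanishes: by [q0] at zeros of [q (x + v x)],
       by the Euler-Lagrange equation elsewhere. *)
    have [f0|f0] := eqVneq (derive1 (derive1 f) (X x)) 0.
      by rewrite f0 mul0r.
    rewrite [X in _ * X]derive_eq0_partial ?mulr0// => i.
    have [/q0//|qN0] := eqVneq (q (x + v x)) 0.
    have /eqP := (ELE _ _ f_adm xi_J).1 v_EL i x.
    by rewrite 2!mulf_eq0 (negPf f0) (negPf qN0) => /eqP.
  have -> : X = cst (X x) by apply/funext => y; exact: Xcst.
  by rewrite /partial derive_cst.
split=> [x /=|K g g_adm xi_K]; last first.
  by apply/(ELE _ _ g_adm xi_K) => j x; rewrite X0 mulr0.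
(* With a zero gradient of [X], [dXE] says that a nonzero determinant times the [i]-th entry of the
   equation is 0. *)
apply/rowP => i; have := dXE i x; rewrite [partial _ _ _]X0 mulr0 => /esym/eqP.
rewrite mulf_eq0; have := v_unit x; rewrite unitmxE unitfE => /negPf ->/= /eqP H.
by rewrite !mxE -[LHS]H.
Qed.
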